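(* Let $G$ be a finite group, let $\pi : G\to U_n(\mathbb{C})$ be a unitary representation, and let $C_1,\ldots,C_M$ be an orthogonal basis (with respect to the trace inner product) of the algebra $(\mathbb{C}^{n\times n})^G$ of $G$-invariant matrices. For $r=1,\ldots,M$ define the matrix $L(C_r)\in\mathbb{C}^{M\times M}$ by $$(L(C_r))_{st} = \frac{\langle C_r C_t, C_s\rangle}{\|C_t\|\,\|C_s\|},\qquad s,t=1,\ldots,M.$$ Let $\mathcal{L}$ be the algebra generated by the matrices $L(C_1),\ldots,L(C_M)$. Then the linear map $$\phi : (\mathbb{C}^{n \times n})^G \to \mathcal{L}, \quad \phi(C_r) = L(C_r), \quad r = 1, \ldots, M,$$ is a $*$-isomorphism.
   Context: $U_n(\mathbb{C})$ is the group of unitary $n\times n$ matrices and a unitary representation is a group homomorphism $\pi:G\to U_n(\mathbb{C})$. The algebra of $G$-invariant matrices is $(\mathbb{C}^{n\times n})^G=\{X\in\mathbb{C}^{n\times n} : \pi(g)X\pi(g)^*=X \text{ for all } g\in G\}$. The trace inner product is $\langle X,Y\rangle=\operatorname{trace}(Y^*X)$ and $\|X\|=\sqrt{\langle X,X\rangle}$. A $*$-isomorphism between algebras of complex matrices closed under conjugate transpose is a bijective $\mathbb{C}$-linear map $\phi$ with $\phi(AB)=\phi(A)\phi(B)$ and $\phi(A^* )=\phi(A)^*$ for all $A,B$. *)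

(* Defs.v *)
From mathcomp Require Import all_boot all_order all_fingroup all_algebra.
From mathcomp Require Import all_character.
From mathcomp Require Import sesquilinear spectral.
From mathcomp Require Import classical_sets functions reals.
From mathcomp Require Import complex.

Set Implicit Arguments.
Unset Strict Implicit.
Unset Printing Implicit Defensive.

Import Order.TTheory GRing.Theory Num.Theory.
Local Open Scope ring_scope.
Local Open Scope sesquilinear_scope.
Local Open Scope classical_set_scope.

Section MatrixStarAlgebras.
Variable K : numClosedFieldType.

Definition mxdot n (X Y : 'M[K]_n) : K := \tr (Y^t* *m X).

Definition mxnorm n (X : 'M[K]_n) : K := sqrtC (mxdot X X).

(* Subalgebras are unital. They are plain sets because 'M[K]_n only carries an
   algebra structure of the library when n is a successor. *)
Definition subalgebra n (A : set 'M[K]_n) : Prop :=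
  [/\ A 1%:M,
      forall (a : K) X Y, A X -> A Y -> A (a *: X + Y)
    & forall X Y, A X -> A Y -> A (X *m Y)].

Definition star_subalgebra n (A : set 'M[K]_n) : Prop :=
  subalgebra A /\ (forall X, A X -> A (X^t*)).

Definition generated_algebra n (S : set 'M[K]_n) : set 'M[K]_n :=
  smallest (@subalgebra n) S.

(* Maps between subalgebras are represented by functions on all matrices, of
   which only the values on the source A matter. *)
Definition linear_on m n (A : set 'M[K]_m) (phi : 'M[K]_m -> 'M[K]_n) : Prop :=
  forall (a : K) X Y, A X -> A Y -> phi (a *: X + Y) = a *: phi X + phi Y.

Definition star_isomorphism m n (A : set 'M[K]_m) (B : set 'M[K]_n)
    (phi : 'M[K]_m -> 'M[K]_n) : Prop :=
  [/\ star_subalgebra A /\ star_subalgebra B,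
      set_bij A B phi,
      linear_on A phi,
      forall X Y, A X -> A Y -> phi (X *m Y) = phi X *m phi Y
    & forall X, A X -> phi (X^t*) = (phi X)^t*].

Definition orthogonal_basis n M (A : set 'M[K]_n) (C : M.-tuple 'M[K]_n) : Prop :=
  [/\ free C,
      A = [set X | X \in <<C>>%VS]
    & forall r s, r != s -> mxdot (tnth C r) (tnth C s) = 0].

(* The matrix of left multiplication by C_r in the normalized basis. *)
Definition left_regular_mx n M (C : M.-tuple 'M[K]_n) (r : 'I_M) : 'M[K]_M :=
  \matrix_(s, t) (mxdot (tnth C r *m tnth C t) (tnth C s)
                  / (mxnorm (tnth C t) * mxnorm (tnth C s))).

Definition unitary_repr (gT : finGroupType) (G : {group gT}) n
    (rho : mx_representation K G n) : Prop :=
  forall g, g \in G -> rho g \is unitarymx.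

Definition invariant_matrices (gT : finGroupType) (G : {group gT}) n
    (rho : mx_representation K G n) : set 'M[K]_n :=
  [set X | forall g, g \in G -> rho g *m X *m (rho g)^t* = X].

End MatrixStarAlgebras.

(* Main.v *)
(** Left multiplication makes a unital *-subalgebra A of matrices act on itself.
    Its matrix in an orthonormal basis of A gives a map that is multiplicative
    because A is stable under multiplication, compatible with adjoints because
    <X^* Y, Z> = <Y, X Z>, and injective because X 1 = X. The image of a unital
    algebra homomorphism is a subalgebra, so being spanned by the L(C_r) it is
    the algebra that they generate. *)
From HB Require Import structures.
Require Import Defs.
From mathcomp Require Import all_boot all_order all_fingroup all_algebra.
From mathcomp Require Import all_character.
From mathcomp Require Import sesquilinear spectral.
From mathcomp Require Import classical_sets functions reals.
From mathcomp Require Import complex.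

Set Implicit Arguments.
Unset Strict Implicit.
Unset Printing Implicit Defensive.

Import Order.TTheory GRing.Theory Num.Theory.
Local Open Scope ring_scope.
Local Open Scope sesquilinear_scope.
Local Open Scope classical_set_scope.

(** * The trace inner product and its norm *)

Section TraceInnerProduct.
Variables (K : numClosedFieldType) (n : nat).
Implicit Types (a : K) (X Y Z : 'M[K]_n).

Lemma trmxCM X Y : (X *m Y)^t* = Y^t* *m X^t*.
Proof. by rewrite trmx_mul map_mxM. Qed.

Lemma mxdotDl X Y Z : mxdot (X + Y) Z = mxdot X Z + mxdot Y Z.
Proof. by rewrite /mxdot mulmxDr mxtraceD. Qed.

Lemma mxdotZl a X Y : mxdot (a *: X) Y = a * mxdot X Y.
Proof. by rewrite /mxdot -scalemxAr mxtraceZ. Qed.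

Lemma mxdot_suml (I : finType) (F : I -> 'M[K]_n) Y :
  mxdot (\sum_i F i) Y = \sum_i mxdot (F i) Y.
Proof. by rewrite /mxdot mulmx_sumr raddf_sum. Qed.

Lemma mxdotC X Y : mxdot X Y = (mxdot Y X)^*.
Proof.
by rewrite /mxdot -[in RHS]mxtrace_tr -trace_map_mx trmxCM trmxCK.
Qed.

Lemma mxdotZr a X Y : mxdot X (a *: Y) = a^* * mxdot X Y.
Proof. by rewrite mxdotC mxdotZl rmorphM /= -mxdotC. Qed.

Lemma mxdot_adjoint X Y Z : mxdot (X^t* *m Y) Z = mxdot Y (X *m Z).
Proof. by rewrite /mxdot trmxCM mulmxA. Qed.

Lemma mxdotE X Y : mxdot X Y = \sum_j \sum_i (Y i j)^* * X i j.
Proof.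
by apply: eq_bigr => j _; rewrite mxE; apply: eq_bigr => i _; rewrite !mxE.
Qed.

Lemma mxdot_ge0 X : 0 <= mxdot X X.
Proof.
rewrite mxdotE; apply: sumr_ge0 => j _; apply: sumr_ge0 => i _.
by rewrite mulrC mul_conjC_ge0.
Qed.

(** By [mxdotE], [mxdot X X] is the sum of the squared moduli of the entries, and a sum of
    nonnegative terms vanishes only if each term does. *)
Lemma mxdot_eq0 X : (mxdot X X == 0) = (X == 0).
Proof.
apply/eqP/eqP => [|->]; last by rewrite /mxdot mulmx0 mxtrace0.
have ge0 i j : 0 <= (X i j)^* * X i j by rewrite mulrC mul_conjC_ge0.
rewrite mxdotE => /psumr_eq0P X0; apply/matrixP => i j; rewrite mxE.
have /psumr_eq0P Xj0 := X0 (fun j _ => sumr_ge0 _ (fun i _ => ge0 i j)) j isT.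
by apply/eqP; rewrite -mul_conjC_eq0 mulrC Xj0.
Qed.

Lemma mxnorm_conj X : (mxnorm X)^* = mxnorm X.
Proof. by apply: conj_Creal; rewrite ger0_real // sqrtC_ge0 mxdot_ge0. Qed.

Lemma mxnorm_eq0 X : (mxnorm X == 0) = (X == 0).
Proof. by rewrite sqrtC_eq0 mxdot_eq0. Qed.

End TraceInnerProduct.

(** * Maps that are linear on a span *)

Section LinearOn.
Variables (K : numClosedFieldType) (m n M : nat) (C : M.-tuple 'M[K]_m).
Implicit Type A : set 'M[K]_m.

(** Induction principle for the span. It serves to compare two linear maps on a basis and to place
    the image of [A] inside a given subalgebra. *)
Lemma span_smallest (P : set 'M[K]_m) :
  P 0 -> (forall a X Y, P X -> P Y -> P (a *: X + Y)) ->
  (forall r, P (tnth C r)) -> [set X | X \in <<C>>%VS] `<=` P.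
Proof.
move=> P0 Plin PC X /coord_span ->; elim/big_rec: _ => // i Y _ PY.
by apply: Plin => //; rewrite -tnth_nth.
Qed.

Lemma linear_on0 A (phi : 'M[K]_m -> 'M[K]_n) :
  A 0 -> linear_on A phi -> phi 0 = 0.
Proof.
move=> A0 /(_ (-1) 0 0 A0 A0).
by rewrite scaler0 addr0 scaleN1r addNr.
Qed.

Lemma linear_on_eq A (phi psi : 'M[K]_m -> 'M[K]_n) :
  A = [set X | X \in <<C>>%VS] -> linear_on A phi -> linear_on A psi ->
  (forall r, phi (tnth C r) = psi (tnth C r)) -> forall X, A X -> phi X = psi X.
Proof.
move=> defA phiL psiL eqC.
have A0 : A 0 by rewrite defA /= mem0v.
(* Membership in [A] is carried through the induction because [phi] and [psi] are linear there
   only. *)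
suff sub : A `<=` [set X | A X /\ phi X = psi X] by move=> X /sub[].
rewrite [X in X `<=` _]defA; apply: span_smallest => [|a X Y [AX eX] [AY eY]|r].
- by rewrite /= (linear_on0 A0 phiL) (linear_on0 A0 psiL).
- rewrite /= phiL // psiL // eX eY; split=> //.
  by move: AX AY; rewrite defA /= => *; rewrite rpredD ?rpredZ.
- by split=> //; rewrite defA /= memv_span ?mem_tnth.
Qed.

End LinearOn.

(** * Left multiplication in the normalized basis *)

Section LeftRegular.
Variables (K : numClosedFieldType) (n M : nat).
Variables (A : set 'M[K]_n) (C : M.-tuple 'M[K]_n).
Hypotheses (starA : star_subalgebra A) (basisC : orthogonal_basis A C).

Let e (t : 'I_M) : 'M[K]_n := (mxnorm (tnth C t))^-1 *: tnth C t.

(** For arbitrary [X] this is the compression to [A] of left multiplication by [X], so it is linear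
    on all matrices; for [X] in [A] it is left multiplication on [A] itself. *)
Definition left_mul_mx (X : 'M[K]_n) : 'M[K]_M :=
  \matrix_(s, t) mxdot (X *m e t) (e s).

Let defA : A = [set X | X \in <<C>>%VS]. Proof. by case: basisC. Qed.
Let A_1 : A 1%:M. Proof. by case: starA => -[]. Qed.
Let A_lin a X Y : A X -> A Y -> A (a *: X + Y).
Proof. by case: starA => -[_ + _ _]; apply. Qed.
Let A_mul X Y : A X -> A Y -> A (X *m Y).
Proof. by case: starA => -[_ _ + _]; apply. Qed.
Let A_star X : A X -> A (X^t*).
Proof. by case: starA => _; apply. Qed.
Let A_0 : A 0. Proof. by rewrite defA /= mem0v. Qed.
Let A_C r : A (tnth C r). Proof. by rewrite defA /= memv_span ?mem_tnth. Qed.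
Let A_e r : A (e r).
Proof. by rewrite -[e r]addr0; apply: A_lin. Qed.

Let normC_neq0 r : mxnorm (tnth C r) != 0.
Proof.
case: basisC => freeC _ _; rewrite mxnorm_eq0; apply/eqP => C0.
by have := free_not0 freeC (mem_tnth r C); rewrite C0 eqxx.
Qed.

Let e_dot s t : mxdot (e t) (e s) = (s == t)%:R.
Proof.
rewrite mxdotZl mxdotZr fmorphV /= mxnorm_conj.
have [->|neq] := eqVneq s t; last first.
  by case: basisC => _ _ ->; rewrite ?mulr0 // eq_sym.
by rewrite -[mxdot _ _]sqrtCK -/(mxnorm _) expr2 mulKf ?mulVf.
Qed.

Let e_expand X : A X -> X = \sum_t mxdot X (e t) *: e t.
Proof.
rewrite defA /= => /coord_span EX.
(* The coordinates along [C] are rescaled to coordinates along [e]; pairing with [e t] then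
   identifies them. *)
have {}EX : X = \sum_t (coord C t X * mxnorm (tnth C t)) *: e t.
  by rewrite [LHS]EX; apply: eq_bigr => t _; rewrite scalerA mulfK // -tnth_nth.
rewrite {1}EX; apply: eq_bigr => t _; congr (_ *: _).
rewrite [in RHS]EX mxdot_suml (bigD1 t) //= mxdotZl e_dot eqxx mulr1.
rewrite big1 ?addr0 // => s neq.
by rewrite mxdotZl e_dot eq_sym (negPf neq) mulr0.
Qed.

Lemma left_mul_mx_basis r : left_mul_mx (tnth C r) = left_regular_mx C r.
Proof.
apply/matrixP => s t; rewrite !mxE -scalemxAr mxdotZl mxdotZr fmorphV /=.
by rewrite mxnorm_conj mulrA -invfM mulrC.
Qed.

Lemma left_mul_mx_linear : linear left_mul_mx.
Proof.
move=> a X Y; apply/matrixP => s t; rewrite !mxE mulmxDl -scalemxAl.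
by rewrite mxdotDl mxdotZl.
Qed.

HB.instance Definition _ :=
  GRing.isLinear.Build K 'M[K]_n 'M[K]_M *:%R left_mul_mx left_mul_mx_linear.

Lemma left_mul_mx1 : left_mul_mx 1%:M = 1%:M.
Proof. by apply/matrixP => s t; rewrite !mxE mul1mx e_dot. Qed.

Lemma left_mul_mxM X Y : A Y ->
  left_mul_mx (X *m Y) = left_mul_mx X *m left_mul_mx Y.
Proof.
move=> AY; apply/matrixP => s t; rewrite !mxE -mulmxA.
(* [Y *m e t] stays in [A], so its expansion in the orthonormal basis produces the sum over the
   middle index of the matrix product. *)
rewrite [in LHS](e_expand (A_mul AY (A_e t))) mulmx_sumr mxdot_suml.
by apply: eq_bigr => u _; rewrite !mxE -scalemxAr mxdotZl mulrC.
Qed.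

Lemma left_mul_mx_star X : left_mul_mx (X^t*) = (left_mul_mx X)^t*.
Proof.
by apply/matrixP => s t; rewrite !mxE mxdot_adjoint mxdotC.
Qed.

Lemma left_mul_mx_inj X Y : A X -> A Y ->
  left_mul_mx X = left_mul_mx Y -> X = Y.
Proof.
move=> AX AY eqXY; apply/eqP; rewrite -subr_eq0; apply/eqP.
have AZ : A (X - Y) by rewrite -scaleN1r addrC; apply: A_lin.
have {eqXY} /matrixP Z0 : left_mul_mx (X - Y) = 0.
  by rewrite linearB /= eqXY subrr.
(* With [Z = X - Y], expanding the identity along [e] reduces [Z = 0] to [Z *m e t = 0]. The
   coordinates of [Z *m e t] form column [t] of the matrix of [Z], which is zero. *)
rewrite -[X - Y]mulmx1 (e_expand A_1) mulmx_sumr big1 // => t _.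
rewrite -scalemxAr (e_expand (A_mul AZ (A_e t))) big1 ?scaler0 // => s _.
by have := Z0 s t; rewrite !mxE => ->; rewrite scale0r.
Qed.

Lemma left_mul_mx_image_star : star_subalgebra (left_mul_mx @` A).
Proof.
split; last first.
  move=> _ [X AX <-]; exists (X^t*); first exact: A_star.
  exact: left_mul_mx_star.
split=> [|a _ _ [X AX <-] [Y AY <-]|_ _ [X AX <-] [Y AY <-]].
- by exists 1%:M; rewrite ?left_mul_mx1.
- by exists (a *: X + Y); [exact: A_lin|rewrite linearP].
- by exists (X *m Y); [exact: A_mul|exact: left_mul_mxM].
Qed.

Lemma generated_left_regular :
  generated_algebra (range (left_regular_mx C)) = left_mul_mx @` A.
Proof.
rewrite eqEsubset; split.
  apply: smallest_sub; first by case: left_mul_mx_image_star.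
  by move=> _ [r _ <-]; exists (tnth C r); rewrite ?left_mul_mx_basis.
move=> _ [X AX <-] B [subB genB]; case: (subB) => B1 Blin _.
(* Linear combinations of the generators already fill the image, so closure of [B] under products is
   not called upon here. *)
suff sub : [set X | X \in <<C>>%VS] `<=` left_mul_mx @^-1` B.
  by apply: sub; move: AX; rewrite defA.
apply: span_smallest => [|a Y Z BY BZ|r] /=.
(* Zero is reached in [B] as the combination [-1 *: 1%:M + 1%:M]. *)
- by rewrite linear0 -(addNr 1%:M) -scaleN1r; apply: Blin.
- by rewrite linearP; apply: Blin.
- by rewrite left_mul_mx_basis; apply: genB; exists r.
Qed.

Lemma left_regular_star_isomorphism (phi : 'M[K]_n -> 'M[K]_M) :
  linear_on A phi -> (forall r, phi (tnth C r) = left_regular_mx C r) ->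
  star_isomorphism A (generated_algebra (range (left_regular_mx C))) phi.
Proof.
move=> phiL phiC.
(* Values of [phi] outside [A] are arbitrary, so the two maps are identified on [A] alone. *)
have phiE : forall X, A X -> phi X = left_mul_mx X.
  apply: (linear_on_eq defA phiL) => [a X Y _ _|r].
    exact: left_mul_mx_linear.
  by rewrite phiC left_mul_mx_basis.
rewrite generated_left_regular; split=> //.
- by split=> //; exact: left_mul_mx_image_star.
- split=> [X AX|X Y /set_mem AX /set_mem AY|_ [X AX <-]].
  + by rewrite phiE //; exists X.
  + by rewrite !phiE //; apply: left_mul_mx_inj.
  + by exists X => //; rewrite phiE.
- by move=> X Y AX AY; rewrite !phiE ?left_mul_mxM //; apply: A_mul.
- by move=> X AX; rewrite !phiE ?left_mul_mx_star //; apply: A_star.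
Qed.

End LeftRegular.

(** * The algebra of invariant matrices *)

Lemma invariant_matrices_star (K : numClosedFieldType) (gT : finGroupType)
    (G : {group gT}) n (rho : mx_representation K G n) :
  unitary_repr rho -> star_subalgebra (invariant_matrices rho).
Proof.
move=> rhoU; split; first split.
(* Invariance of the identity is unitarity of [rho g]. *)
- by move=> g /rhoU /unitarymxP; rewrite mulmx1.
- move=> a X Y IX IY g Gg.
  by rewrite mulmxDr mulmxDl -scalemxAr -scalemxAl IX // IY.
(* Both factors are replaced by their conjugates, and the inner [(rho g)^t* *m rho g] cancels by
   unitarity. *)
- move=> X Y IX IY g Gg; rewrite -[in RHS](IX g Gg) -[in RHS](IY g Gg).
  by rewrite !mulmxA mulmxKtV // rhoU.
- by move=> X IX g Gg; rewrite -[in RHS](IX g Gg) !trmxCM trmxCK mulmxA.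
Qed.

Theorem theorem1p3 (R : realType) (gT : finGroupType) (G : {group gT}) (n : nat)
    (rho : mx_representation R[i] G n) (M : nat) (C : M.-tuple 'M[R[i]]_n) :
  unitary_repr rho ->
  orthogonal_basis (invariant_matrices rho) C ->
  let A := invariant_matrices rho in
  let L := generated_algebra (range (left_regular_mx C)) in
  let extends_basis (phi : 'M[R[i]]_n -> 'M[R[i]]_M) :=
    linear_on A phi /\ (forall r : 'I_M, phi (tnth C r) = left_regular_mx C r) in
  (exists phi, extends_basis phi) /\
  (forall phi, extends_basis phi -> star_isomorphism A L phi).
Proof.
move=> rhoU basisC /=; split.
  exists (left_mul_mx C); split; last exact: left_mul_mx_basis.
  by move=> a X Y _ _; exact: left_mul_mx_linear.
move=> phi [phiL phiC].
exact: (left_regular_star_isomorphism (invariant_matrices_star rhoU)).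
Qed.
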